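(* Let $B$ be a real separable Banach space with dual $B^*$, and let $X$ be a random element taking values in $B$, defined on a probability space $(\Omega,\mathcal{F},P)$, with probability distribution $\mu$ satisfying $\int_B\|x\|^2\,\mu(dx)<\infty$. Let $P^*$ be a probability measure on $(B^*,\mathcal{B}(B^* ))$. Let $S:B^*\to B$ be the covariance operator of $X$, i.e. the unique bounded linear operator satisfying $$(Sf,g)=\int_B (x,f)(x,g)\,\mu(dx)\qquad\text{for all } f,g\in B^*.$$ Then for every $\varepsilon>0$, $$P^*\{f\in B^*:(Sf,f)\ge\varepsilon\}\le\frac{1}{\varepsilon}\int_{B^*}(\|f\|^* )^2\,P^*(df)\left(\int_B\|x\|^2\,\mu(dx)\right).$$ Moreover, if $S$ is positive definite (that is, $(Sf,f)=0$ implies $f=0$) and invertible, with inverse $S^{-1}:B\to B^*$, then for every $\varepsilon>0$, $$P\{(S^{-1}X,X)\ge\varepsilon\}\le\frac{1}{\varepsilon}\,\|S^{-1}\|^2\left[\int_B\|x\|^2\,\mu(dx)\right]^2.$$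
   Context: $B$ is a real separable Banach space with norm $\|\cdot\|$ and Borel $\sigma$-algebra $\mathcal{B}(B)$. $B^*$ is the space of bounded linear functionals on $B$, with the operator norm $\|f\|^*=\sup_{\|x\|\le 1}|f(x)|$, and $\mathcal{B}(B^* )$ is its (norm) Borel $\sigma$-algebra. A random element taking values in $B$ is a measurable map $X:(\Omega,\mathcal{F})\to(B,\mathcal{B}(B))$, where $(\Omega,\mathcal{F},P)$ is a probability space; its probability distribution is the measure $\mu(A)=P(X^{-1}(A))$ for $A\in\mathcal{B}(B)$. For $x\in B$ and $f\in B^*$, write $(x,f)=(f,x)=f(x)$. Under the assumption $\int_B\|x\|^2\mu(dx)<\infty$, a unique bounded linear operator $S:B^*\to B$ with the stated defining property exists. $\|S^{-1}\|$ denotes the operator norm of $S^{-1}:B\to B^*$. The integral $\int_{B^*}(\|f\|^* )^2P^*(df)$ takes values in $[0,\infty]$, with the usual convention $0\cdot\infty=0$. *)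

(* Defs.v *)
From HB Require Import structures.
From mathcomp Require Import all_boot all_order all_algebra.
From mathcomp Require Import all_classical all_reals all_analysis.

Set Implicit Arguments.
Unset Strict Implicit.
Unset Printing Implicit Defensive.

Import Order.TTheory GRing.Theory Num.Theory.
Import numFieldNormedType.Exports.

Local Open Scope classical_set_scope.
Local Open Scope ring_scope.

Definition separable (T : topologicalType) : Prop :=
  exists2 D : set T, countable D & dense D.

(* [T] with its Borel sigma-algebra; the carrier is [T] itself. *)
Notation borel T := (g_sigma_algebraType (@open T)).

Section bounded_operators.
Context {R : realType} {V W : normedModType R}.

Definition bounded_op (f : V -> W) : Prop :=
  exists M : R, forall x, `|f x| <= M * `|x|.

(* [sup] of an unbounded set is 0, so this is the operator norm only for a
   bounded [f]. A two-sided inverse of a covariance operator on a Banach space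
   is bounded (bounded inverse theorem). *)
Definition opnorm (f : V -> W) : R :=
  sup [set `|f x| | x in [set x : V | `|x| <= 1]].

End bounded_operators.

Section bounded_operators_theory.
Context {R : realType} {V W : normedModType R}.
Implicit Types f : V -> W.

Lemma opnorm_has_sup f : bounded_op f ->
  has_sup [set `|f x| | x in [set x : V | `|x| <= 1]].
Proof.
move=> [M fM]; split; first by exists `|f 0|, 0 => //=; rewrite normr0.
exists `|M| => _ [x /= x1 <-]; apply: (le_trans (fM x)).
apply: (@le_trans _ _ (`|M| * `|x|)); first by rewrite ler_wpM2r// ler_norm.
by rewrite ler_piMr.
Qed.

Lemma opnorm_ge0 f : bounded_op f -> 0 <= opnorm f.
Proof.
move=> /opnorm_has_sup[_ fub]; apply: (@le_trans _ _ `|f 0|) => //.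
by apply: (ub_le_sup fub); exists 0 => //=; rewrite normr0.
Qed.

Lemma le_opnorm f x : linear f -> bounded_op f -> `|f x| <= opnorm f * `|x|.
Proof.
move=> lf bf; have [_ fub] := opnorm_has_sup bf.
pose g : {linear V -> W} := HB.pack f (GRing.isLinear.Build _ _ _ _ _ lf).
have -> : f = g :> (V -> W) by [].
have [->|x0] := eqVneq x 0; first by rewrite linear0 !normr0 mulr0.
rewrite -ler_pdivrMr ?normr_gt0//; apply: (ub_le_sup fub).
exists (`|x|^-1 *: x) => /=.
  by rewrite normrZ normfV normr_id mulVf ?normr_eq0.
by rewrite -[f]/(g : V -> W) linearZ/= normrZ normfV normr_id mulrC.
Qed.

Lemma opnorm_le f M : (forall x, `|x| <= 1 -> `|f x| <= M) -> opnorm f <= M.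
Proof.
move=> fM; apply: ge_sup; first by exists `|f 0|, 0 => //=; rewrite normr0.
by move=> _ [x /= x1 <-]; exact: fM.
Qed.

End bounded_operators_theory.

Section dual.
Context {R : realType} (V : normedModType R).

Definition bounded_functional : {pred V -> R^o} :=
  mem [set f : V -> R^o | linear f /\ bounded_op f].

Lemma bounded_functionalP (f : V -> R^o) :
  reflect (linear f /\ bounded_op f) (f \in bounded_functional).
Proof. by apply: (iffP idP); rewrite inE. Qed.

Record dual := Dual {
  dual_fun :> V -> R^o;
  dual_funP : dual_fun \in bounded_functional }.

HB.instance Definition _ := [isSub for dual_fun].
HB.instance Definition _ := gen_eqMixin dual.
HB.instance Definition _ := gen_choiceMixin dual.

Lemma bounded_functional_submod_closed : submod_closed bounded_functional.
Proof.
split.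
  apply/bounded_functionalP; split=> [a x y|]; first by rewrite scaler0 addr0.
  by exists 0 => x; rewrite normr0 mul0r.
move=> a f g /bounded_functionalP[lf [M fM]] /bounded_functionalP[lg [N gN]].
apply/bounded_functionalP; split=> [b x y|].
  have E z : (a *: f + g) z = a *: f z + g z by [].
  rewrite !E lf lg !scalerDr scalerA mulrC -scalerA !addrA; congr (_ + _).
  by rewrite addrAC.
exists (`|a| * M + N) => x; rewrite mulrDl (le_trans (ler_normD _ _))//.
by rewrite lerD// normrZ -mulrA ler_wpM2l.
Qed.

HB.instance Definition _ := GRing.isSubmodClosed.Build R (V -> R^o)
  bounded_functional bounded_functional_submod_closed.
HB.instance Definition _ := [SubChoice_isSubLmodule of dual by <:].

Lemma dual_linear (f : dual) : linear f.
Proof. by case/bounded_functionalP: (dual_funP f). Qed.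

Lemma dual_bounded (f : dual) : bounded_op f.
Proof. by case/bounded_functionalP: (dual_funP f). Qed.

HB.instance Definition _ (f : dual) :=
  GRing.isLinear.Build R V R^o *:%R f (dual_linear f).

Lemma dualP (f g : dual) : f =1 g -> f = g.
Proof. by move=> fg; apply: val_inj; apply/funext. Qed.

Lemma dualD (f g : dual) x : (f + g) x = f x + g x.
Proof. by []. Qed.

Lemma dualZ (a : R) (f : dual) x : (a *: f) x = a * f x.
Proof. by []. Qed.

Let dual_norm (f : dual) : R := opnorm f.

Let dual_normD f g : dual_norm (f + g) <= dual_norm f + dual_norm g.
Proof.
apply: opnorm_le => x x1; rewrite dualD (le_trans (ler_normD _ _))// lerD//.
  apply: (ub_le_sup (opnorm_has_sup (dual_bounded f)).2); by exists x.
apply: (ub_le_sup (opnorm_has_sup (dual_bounded g)).2); by exists x.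
Qed.

Let dual_normZ_le a f : dual_norm (a *: f) <= `|a| * dual_norm f.
Proof.
apply: opnorm_le => x x1; rewrite dualZ normrM ler_wpM2l//.
apply: (ub_le_sup (opnorm_has_sup (dual_bounded f)).2); by exists x.
Qed.

Let dual_normZ a f : dual_norm (a *: f) = `|a| * dual_norm f.
Proof.
apply/eqP; rewrite eq_le dual_normZ_le/=.
have [->|a0] := eqVneq a 0.
  by rewrite normr0 mul0r; apply: opnorm_ge0; exact: dual_bounded.
rewrite -ler_pdivlMl ?normr_gt0// -normfV.
by have := dual_normZ_le a^-1 (a *: f); rewrite scalerA mulVf// scale1r.
Qed.

Let dual_norm0_eq0 f : dual_norm f = 0 -> f = 0.
Proof.
move=> f0; apply: dualP => x; apply/eqP; rewrite -normr_le0.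
rewrite (le_trans (le_opnorm x (dual_linear f) (dual_bounded f)))//.
by rewrite -/(dual_norm f) f0 mul0r.
Qed.

(* The topology of [dual], hence its Borel sigma-algebra, is that of the
   operator norm. *)
HB.instance Definition _ := Lmodule_isNormed.Build R dual
  dual_normD dual_normZ dual_norm0_eq0.

Lemma dual_normE (f : dual) : `|f| = opnorm f.
Proof. by []. Qed.

End dual.

Section covariance.
Context {R : realType} {B : normedModType R}.

Definition is_covariance_operator (mu : probability (borel B) R)
    (S : {linear dual B -> B}) : Prop :=
  bounded_op S /\
  forall f g : dual B,
    ((g (S f))%:E = \int[mu]_x (f (x : B) * g (x : B))%:E)%E.

Definition positive_definite (S : dual B -> B) : Prop :=
  forall f : dual B, f (S f) = 0 -> f = 0.

End covariance.

(* Main.v *)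
(* Both bounds are Markov's inequality for a quadratic form [q x <= c |x|^2].
   With [C] the integral of [|x|^2] against the law of [X], the covariance
   identity gives [f (S f) = E (f X)^2 <= C |f|^2]; taking [f = Sinv x] it gives
   [Sinv x x <= C |Sinv|^2 |x|^2].  The latter needs [Sinv] to be bounded: since
   [S] is symmetric, so is [Sinv], and the Hellinger-Toeplitz argument (uniform
   boundedness principle) applies. *)
Require Import Defs.
From HB Require Import structures.
From mathcomp Require Import all_boot all_order all_algebra.
From mathcomp Require Import all_classical all_reals all_analysis.
From mathcomp Require Import measurable_realfun ring.

Set Implicit Arguments.
Unset Strict Implicit.
Unset Printing Implicit Defensive.

Import Order.TTheory GRing.Theory Num.Theory.
Import numFieldNormedType.Exports.

Local Open Scope classical_set_scope.
Local Open Scope ring_scope.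
Local Open Scope ereal_scope.

Lemma borel_measurable_fun (R : realType) (T : ptopologicalType) (q : T -> R) :
  continuous q -> measurable_fun setT (q : borel T -> R).
Proof.
move=> /continuousP cq.
apply: (measurability _ (RGenOInfty.measurableE R)) => _ [_ [a ->] <-].
by rewrite setTI; apply: sub_sigma_algebra; exact/cq/interval_open.
Qed.

Lemma borel_measurable_sqr_norm (R : realType) (V : normedModType R) :
  measurable_fun setT (fun x : borel V => (`|x : V| ^+ 2)%:E).
Proof.
apply/measurable_EFinP.
apply: (@borel_measurable_fun R V (fun x => `|x| ^+ 2)%R) => x.
by apply: cvgM; exact: norm_continuous.
Qed.

(** On the event, [eps <= q x <= c * |x|^2]; integrate this over the event, then enlarge the domain
    to the whole space. Only nonnegative integrals are compared, so the second moment of [Q] may be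
    infinite, as is allowed for [Pstar]. *)
Lemma markov_quadratic (R : realType) (V : normedModType R)
    (Q : probability (borel V) R) (q : V -> R) (c eps : R) :
  continuous q -> (forall x, q x <= c * `|x| ^+ 2)%R -> (0 <= c)%R ->
  (0 < eps)%R ->
  Q [set x : V | (eps <= q x)%R] <=
    (eps^-1)%:E * (c%:E * \int[Q]_x (`|x : V| ^+ 2)%:E).
Proof.
move=> cq qc c0 eps0; set A := [set x : V | _].
have mq := borel_measurable_fun cq.
have mA : measurable (A : set (borel V)).
  have := mq measurableT `[eps, +oo[%classic (measurable_itv _).
  rewrite setTI (_ : _ @^-1` _ = A)//.
  by apply/seteqP; split=> x /=; rewrite in_itv/= andbT.
have mn := @borel_measurable_sqr_norm R V.
have mcn : measurable_fun setT (fun x : borel V => c%:E * (`|x : V| ^+ 2)%:E).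
  exact: (measurable_funeM (D := setT)) mn.
have cn0 (x : borel V) : 0 <= c%:E * (`|x : V| ^+ 2)%:E.
  by rewrite -EFinM lee_fin mulr_ge0// exprn_ge0.
rewrite lee_pdivlMl// -integral_cst// -ge0_integralZl//.
apply: (@le_trans _ _ (\int[Q]_(x in A) (c%:E * (`|x : V| ^+ 2)%:E))).
  apply: ge0_le_integral => //.
  - by move=> x _ /=; rewrite lee_fin ltW.
  - exact: measurable_funTS.
  - by move=> x /= Ax; rewrite -EFinM lee_fin (le_trans Ax).
by apply: ge0_subset_integral.
Qed.

Section dual_pairing.
Context {R : realType} {V : normedModType R}.
Local Open Scope ring_scope.

Lemma le_dual_norm (f : dual V) (x : V) : `|f x : R| <= `|f| * `|x|.
Proof. exact: le_opnorm (dual_linear f) (dual_bounded f). Qed.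

(** Makes the quadratic forms [f (S f)] and [Sinv x x] continuous, hence Borel measurable: in each,
    the functional and its argument vary together. *)
Lemma dual_pairing_continuous (T : topologicalType) (F : T -> dual V)
    (G : T -> V) :
  continuous F -> continuous G -> continuous (fun t => F t (G t) : R).
Proof.
move=> cF cG t.
have bound s : `|(F s (G s) : R) - F t (G t)| <=
    `|F s - F t| * `|G s| + `|F t| * `|G s - G t|.
  have -> : (F s (G s) : R) - F t (G t) =
      ((F s - F t) (G s) : R) + (F t (G s - G t) : R).
    have telescope (a b c : R) : a - c = (a - b) + (b - c) by ring.
    by rewrite linearB; exact: telescope.
  rewrite (le_trans (ler_normD _ _))//.
  by apply: lerD; exact: le_dual_norm.
apply/subr_cvg0/norm_cvg0P.
apply: (@squeeze_cvgr _ _ _ _ (cst 0)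
  (fun s => `|F s - F t| * `|G s| + `|F t| * `|G s - G t|)).
- by near=> s; rewrite normr_ge0/= bound.
- exact: cvg_cst.
- have nB0 (W : normedModType R) (h : T -> W) : h @ t --> h t ->
      `|h s - h t| @[s --> t] --> (0 : R).
    by move=> ch; apply/norm_cvg0P/subr_cvg0.
  rewrite -(addr0 0); apply: cvgD.
    rewrite -(mul0r `|G t|); apply: cvgM; first exact: nB0 (cF t).
    by apply: cvg_norm; exact: cG.
  rewrite -(mulr0 `|F t|); apply: cvgM; first exact: cvg_cst.
  exact: nB0 (cG t).
Unshelve. all: by end_near. Qed.

End dual_pairing.

Lemma bounded_op_continuous (R : realType) (V W : normedModType R)
  (f : V -> W) : linear f -> bounded_op f -> continuous f.
Proof.
move=> lf [M fM].
pose g : {linear V -> W} := HB.pack f (GRing.isLinear.Build _ _ _ _ _ lf).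
suff: bounded_near g (nbhs (0%R : V)) by exact: bounded_linear_continuous.
apply/bounded_funP => r.
exists (`|M| * r)%R => x xr; apply: (le_trans (fM x)).
by rewrite (le_trans (ler_wpM2r _ (ler_norm M)))// ler_wpM2l.
Qed.

Section symmetric_operator.
Context {R : realType} {B : completeNormedModType R}.
Local Open Scope ring_scope.
Variable T : B -> dual B.
Hypothesis symT : forall x y, T x y = T y x.

(** Symmetry moves the variable into the argument of the fixed functional [T z], which is linear. *)
Lemma symmetric_linear : linear T.
Proof.
by move=> a x y; apply: dualP => z; rewrite dualD dualZ symT linearP/= !(symT z).
Qed.

Lemma Hellinger_Toeplitz : bounded_op T.
Proof.
(* The normalised functionals [T y / |y|]; for [y = 0] the inverse is 0 by convention and the member
   is the zero functional. *)
pose F := [set dual_fun (`|y|^-1 *: T y) | y in [set: B]].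
have [] := @Banach_Steinhauss R B R^o F _ _ 1.
- move=> _ [y _ <-]; split; last exact: dual_linear.
  move=> r; exists (`|(`|y|^-1 *: T y)| * r) => x xr.
  by rewrite (le_trans (le_dual_norm _ _))// ler_wpM2l.
(* Pointwise boundedness comes from symmetry: [|T y x| = |T x y| <= |T x| * |y|]. *)
- move=> x; exists `|T x| => _ [y _ <-]; rewrite dualZ symT normrM.
  have [->|y0] := eqVneq y 0; first by rewrite linear0 !normr0 mulr0.
  by rewrite normfV normr_id ler_pdivrMl ?normr_gt0// mulrC le_dual_norm.
move=> M FM; exists M => y; apply: opnorm_le => x x1.
have [->|y0] := eqVneq y 0; first by rewrite symT linear0 !normr0 mulr0.
have := FM _ (imageT _ y) x x1; rewrite dualZ normrM normfV normr_id.
by rewrite ler_pdivrMl ?normr_gt0// mulrC.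
Qed.

End symmetric_operator.

Lemma covariance_form_le (R : realType) (B : normedModType R)
    (mu : probability (borel B) R) (S : {linear dual B -> B}) (f : dual B) :
  is_covariance_operator mu S ->
  (f (S f))%:E <= (`|f| ^+ 2)%:E * \int[mu]_x (`|x : B| ^+ 2)%:E.
Proof.
move=> [_ covS]; rewrite covS.
have mn := @borel_measurable_sqr_norm R B.
rewrite -ge0_integralZl//.
apply: ge0_le_integral => //.
- by move=> x _; rewrite lee_fin -expr2 sqr_ge0.
- have cf := bounded_op_continuous (dual_linear f) (dual_bounded f).
  apply/measurable_EFinP.
  apply: (@borel_measurable_fun R B (fun x => f x * f x)%R) => x.
  by apply: cvgM; exact: cf.
- exact: (measurable_funeM (D := setT)) mn.
- move=> x _; rewrite -EFinM lee_fin -expr2 -exprMn -real_normK ?num_real//.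
  by rewrite lerXn2r ?nnegrE ?mulr_ge0// le_dual_norm.
Qed.

Theorem theorem2p4 (R : realType) (B : completeNormedModType R)
    (Bsep : separable B)
    (d : measure_display) (Omega : measurableType d) (P : probability Omega R)
    (X : {RV P >-> borel B})
    (X2 : \int[distribution P X]_x (`|x : B| ^+ 2)%:E < +oo)
    (Pstar : probability (borel (dual B)) R)
    (S : {linear dual B -> B})
    (covS : is_covariance_operator (distribution P X) S) :
  (forall eps : R, (0 < eps)%R ->
     Pstar [set f : dual B | (eps <= f (S f))%R] <=
       (eps^-1)%:E * \int[Pstar]_f (`|f : dual B| ^+ 2)%:E
                   * \int[distribution P X]_x (`|x : B| ^+ 2)%:E)
  /\
  (positive_definite S ->
   forall Sinv : B -> dual B, cancel S Sinv -> cancel Sinv S ->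
   forall eps : R, (0 < eps)%R ->
     P [set w | (eps <= Sinv (X w : B) (X w : B))%R] <=
       (eps^-1)%:E * (opnorm Sinv ^+ 2)%:E
                   * (\int[distribution P X]_x (`|x : B| ^+ 2)%:E) ^+ 2).
Proof.
have symS (f g : dual B) : g (S f) = f (S g).
  apply: EFin_inj; rewrite !covS.2.
  by apply: eq_integral => x _; rewrite mulrC.
have C0 : 0 <= \int[distribution P X]_x (`|x : B| ^+ 2)%:E.
  by apply: integral_ge0 => x _; rewrite lee_fin exprn_ge0.
have form_le f := covariance_form_le f covS.
(* The second moment becomes a real [c]: [X2] excludes [+oo] and [C0] excludes [-oo]. *)
move: C0 X2 form_le; case EC: (\int[_]_x _) => [c||]//.
rewrite lee_fin => c0 _ form_le.
have {}form_le (f : dual B) : (f (S f) <= c * `|f| ^+ 2)%R.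
  by rewrite mulrC -lee_fin EFinM form_le.
split=> [eps eps0|_ Sinv SK SinvK eps eps0].
  rewrite -muleA (muleC _ c%:E).
  apply: markov_quadratic => //; apply: dual_pairing_continuous.
    by move=> f; exact: cvg_id.
  exact: bounded_op_continuous (linearP S) covS.1.
(* Symmetry of [S] at the functionals [Sinv x] and [Sinv y], whose images under [S] are [x] and
   [y]. *)
have symSinv x y : Sinv x y = Sinv y x.
  by rewrite -{1}(SinvK y) symS SinvK.
have bSinv := Hellinger_Toeplitz symSinv.
have lSinv := symmetric_linear symSinv.
have cSinv := bounded_op_continuous lSinv bSinv.
(* The event is a preimage under [X], so its probability is the mass given by the law of [X]. One
   factor [c] comes from the covariance bound, the other from the second moment in Markov's
   inequality; hence the square. *)
apply: (@le_trans _ _ ((eps^-1)%:E * ((c * opnorm Sinv ^+ 2)%:E *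
    \int[distribution P X]_x (`|x : B| ^+ 2)%:E))).
  apply: (markov_quadratic (distribution P X) (q := fun x : B => Sinv x x)) => //.
  - by apply: dual_pairing_continuous => // x; exact: cvg_id.
  (* Since [S (Sinv x) = x], the covariance bound reads [Sinv x x <= c * |Sinv x|^2]. *)
  - move=> x; have := form_le (Sinv x); rewrite SinvK => /le_trans; apply.
    rewrite -mulrA -exprMn ler_wpM2l// lerXn2r ?nnegrE ?mulr_ge0 ?(opnorm_ge0 bSinv)//.
    exact: le_opnorm lSinv bSinv.
  - by rewrite mulr_ge0// sqr_ge0.
rewrite EC -EFin_expe -!EFinM lee_fin le_eqVlt.
by apply/orP; left; apply/eqP; ring.
Qed.
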